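(* Let $k\ge3$ and let $\vec{\mathbf n}=(n_1,\dots,n_k)$ be integers with $1\le n_1\le\cdots\le n_k$. Suppose that $\vec{\mathbf n}$ is unbalanced, i.e. $n_k-1\ge\prod_{i=1}^{k-1}(n_i+1)-\sum_{i=1}^{k-1}n_i$. Then: (i) For a non-negative integer $s$, $T(\vec{\mathbf n};s;0^k)$ is true and subabundant if and only if $s\le\prod_{i=1}^{k-1}(n_i+1)-\sum_{i=1}^{k-1}n_i$. (ii) $\underline R(\vec{\mathbf n})=\min\left\{n_k+1,\ \prod_{i=1}^{k-1}(n_i+1)\right\}$.
   Context: Work over a field of characteristic zero (not necessarily algebraically closed). Let $V_i$ be a vector space of dimension $n_i+1$ and let $X=\mathbf{P}^{n_1}\times\cdots\times\mathbf{P}^{n_k}=\mathbf{P}(V_1)\times\cdots\times\mathbf{P}(V_k)$ be the Segre variety embedded in $\mathbf{P}(V_1\otimes\cdots\otimes V_k)$. For a point $p=v_1\otimes\cdots\otimes v_k$ of $X$ let $T_pX=\sum_{i=1}^k v_1\otimes\cdots\otimes v_{i-1}\otimes V_i\otimes v_{i+1}\otimes\cdots\otimes v_k$ be the affine tangent space, a subspace of $V_1\otimes\cdots\otimes V_k$. The statement $T(\vec{\mathbf n};s;0^k)$ is said to be true if, for $s$ generic points $p_1,\dots,p_s\in X$, the subspace $T_{p_1}X+\cdots+T_{p_s}X$ has dimension $\min\{s(1+\sum_{i=1}^kn_i),\prod_{i=1}^k(n_i+1)\}$ (equivalently, $\sigma_s(X)$ has the expected dimension). It is subabundant if $s(1+\sum_{i=1}^kn_i)\le\prod_{i=1}^k(n_i+1)$.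 The $s$-secant variety $\sigma_s(X)$ is the Zariski closure of the union of the linear spans of $s$-tuples of points of $X$, and $\underline R(\vec{\mathbf n})$ is the smallest integer $s$ such that $\sigma_s(X)$ is the whole ambient space $\mathbf{P}(V_1\otimes\cdots\otimes V_k)$. *)

(* Defs.v *)
From HB Require Import structures.
From mathcomp Require Import all_boot all_order all_algebra.
From mathcomp Require Import mpoly.

Set Implicit Arguments.
Unset Strict Implicit.
Unset Printing Implicit Defensive.

Import GRing.Theory.

Local Open Scope ring_scope.

(* V_i is F^(n_i + 1), and V_1 (x) ... (x) V_k is the space of arrays with one
   entry for each multi-index j = (j_1, ..., j_k). *)
Section Segre.
Variables (F : fieldType) (k : nat) (n : 'I_k -> nat).

Definition factor (i : 'I_k) := 'rV[F]_(n i).+1.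

Definition mindex := {dffun forall i : 'I_k, 'I_(n i).+1}.

Definition tensor := {ffun mindex -> F^o}.

Definition ptensor (v : forall i, factor i) : tensor :=
  [ffun j : mindex => \prod_i v i 0 (j i)].

(* v_1 (x) ... (x) v_(i-1) (x) w (x) v_(i+1) (x) ... (x) v_k *)
Definition ptensor_at (v : forall i, factor i) (i : 'I_k) (w : factor i) :
  tensor := ptensor (dfwith v w).

Lemma ptensor_at_is_linear v i : linear (@ptensor_at v i).
Proof.
move=> a x y; apply/ffunP=> j; rewrite !ffunE.
rewrite (bigD1 i) //= [X in _ = _ *: X + _](bigD1 i) //=.
rewrite [X in _ = _ + X](bigD1 i) //= !dfwith_in !mxE.
have E (w : factor i) : \prod_(l < k | l != i) dfwith v w l 0 (j l)
           = \prod_(l < k | l != i) v l 0 (j l).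
  by apply: eq_bigr => l; rewrite eq_sym => il; rewrite dfwith_out.
by rewrite !E mulrDl -mulrA.
Qed.

HB.instance Definition _ v i :=
  GRing.isLinear.Build F (factor i) tensor *:%R (@ptensor_at v i)
    (@ptensor_at_is_linear v i).

(* The affine tangent space at the point v_1 (x) ... (x) v_k. *)
Definition tangent (v : forall i, factor i) : {vspace tensor} :=
  (\sum_i limg (linfun (@ptensor_at v i)))%VS.

(* An s-tuple of points of X = P(V_1) x ... x P(V_k) is given by nonzero
   representatives p a i of the components of the points in the P(V_i). *)
Definition rep_tuple (s : nat) := 'I_s -> forall i, factor i.

Definition is_rep_tuple s (p : rep_tuple s) := forall a i, p a i != 0.

(* (a, (i, j)) indexes the j-th homogeneous coordinate of the component in
   P(V_i) of the a-th point. *)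
Definition hcoord (s : nat) : finType :=
  ('I_s * {i : 'I_k & 'I_(n i).+1})%type.

Definition hcoord_val s (p : rep_tuple s) (c : hcoord s) : F :=
  p c.1 (tag c.2) 0 (tagged c.2).

Definition hpoly (s : nat) := {mpoly F[#|hcoord s|]}.

Definition hpoly_eval s (p : rep_tuple s) (f : hpoly s) : F :=
  f.@[fun x => hcoord_val p (enum_val x)].

(* f is homogeneous separately in each of the s * k groups of homogeneous
   coordinates. *)
Definition multihomogeneous s (f : hpoly s) :=
  forall (a : 'I_s) (i : 'I_k), exists d : nat,
  forall m, m \in msupp f ->
    (\sum_(j < (n i).+1)
        m (enum_rank ((a, Tagged (fun i => 'I_(n i).+1) j) : hcoord s)))%N = d.

(* Zariski-open subsets of X^s: complements of the common zero loci of sets of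
   multihomogeneous polynomials. *)
Definition zariski_open s (U : rep_tuple s -> Prop) :=
  exists S : hpoly s -> Prop,
    (forall f, S f -> multihomogeneous f) /\
    (forall p, is_rep_tuple p ->
       (U p <-> exists f, S f /\ hpoly_eval p f != 0)).

Definition generically s (P : rep_tuple s -> Prop) :=
  exists U : rep_tuple s -> Prop,
    [/\ zariski_open U,
        exists p, is_rep_tuple p /\ U p
      & forall p, is_rep_tuple p -> U p -> P p].

(* T(n; s; 0^k) *)
Definition T_true (s : nat) :=
  generically (fun p : rep_tuple s =>
    \dim (\sum_a tangent (p a))%VS
    = minn (s * (1 + \sum_i n i)) (\prod_i (n i).+1))%N.

Definition subabundant (s : nat) :=
  (s * (1 + \sum_i n i) <= \prod_i (n i).+1)%N.

Definition tpoly_eval (t : tensor) (f : {mpoly F[#|{: mindex}|]}) : F :=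
  f.@[fun x => t (enum_val x)].

(* Zariski closure in P(V_1 (x) ... (x) V_k) of a set of points, the points
   being given by nonzero representatives. *)
Definition proj_closure (A : tensor -> Prop) (t : tensor) :=
  t != 0 /\
  forall (d : nat) (f : {mpoly F[#|{: mindex}|]}), f \is d.-homog ->
    (forall u : tensor, u != 0 -> A u -> tpoly_eval u f = 0) -> tpoly_eval t f = 0.

Definition secant_spans (s : nat) (t : tensor) :=
  exists p : rep_tuple s,
    is_rep_tuple p /\ t \in <<[seq ptensor (p a) | a : 'I_s]>>%VS.

Definition secant_variety (s : nat) : tensor -> Prop :=
  proj_closure (secant_spans s).

Definition secant_fills (s : nat) :=
  forall t : tensor, t != 0 -> secant_variety s t.

(* r is the number \underline R(n). *)
Definition is_generic_rank (r : nat) :=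
  secant_fills r /\ forall s, secant_fills s -> (r <= s)%N.

End Segre.

(* k = m.+1, so that n_k is n ord_max.  The subtractions do not truncate when all
   the n_i are positive. *)
Definition unbalanced (m : nat) (n : 'I_m.+1 -> nat) :=
  ((\prod_(i < m.+1 | i != ord_max) (n i).+1)
     - (\sum_(i < m.+1 | i != ord_max) n i) <= n ord_max - 1)%N.

(* Main.v *)
From HB Require Import structures.
Require Import Defs.
From mathcomp Require Import all_boot all_order all_algebra.
From mathcomp Require Import mpoly ring zify.

(** Write P = \prod_(i < k) (n_i + 1), S = \sum_(i < k) n_i and N = n_k, the
product and the sum being over all factors but the last, so that unbalancedness
reads P - S <= N - 1.  The whole argument is the comparison of X with
Y x P(V_k), where Y is the Segre variety of the first k - 1 factors, in a tensor
space A of dimension P.  At p = u (x) w, with u in Y, the tangent space is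
T_u Y (x) w + u (x) V_k ([tangent_tens]).

If s <= N + 1, put the last components of the s points at s different vectors
e_1, ..., e_s of a basis of V_k.  With U the span of u_1, ..., u_s, the sum of
the tangent spaces is then graded by the basis: its component along e_a is
U + T_(u_a) Y for a <= s, and U for the other basis vectors.  For u_1, ..., u_s
generic on Y these have dimensions min(P, s + S) and min(P, s), because Y spans
A and hence a new point escapes from any given proper subspace
([generic_points], [exists_large_tangent_sum]).  For s <= P - S the total is
s (1 + S + N), the expected value; for s = N + 1 < P it is P (N + 1), as
N + S >= P by unbalancedness.

Conversely, let W be the span of the last components, w its dimension and C
a complement of W in V_k.  The sum of the tangent spaces lies in
A (x) W + U (x) C, so has dimension at most w P + s (N + 1 - w)
([dim_tangent_sum_flattening]), which for w <= s <= P is at most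
s (P - s + N + 1); and subabundance gives s <= P.  If T is true and
subabundant, this forces 1 + S + N <= P - s + N + 1 for s > 0, that is
s <= P - S.

For the rank: a tensor is a P x (N + 1) matrix, a sum of s points of X gives a
matrix of rank at most s, and a minor of size s + 1 <= min(P, N + 1) is an
equation of the secant variety which is not satisfied everywhere
([secant_fills_ge]).  If P <= N + 1, splitting the matrix into its rows writes
every tensor as a sum of P points ([secant_fills_init_index]).  Otherwise
s = N + 1 points whose tangent spaces span everything exist by the above, and a
polynomial f vanishing on the secant spans vanishes identically
([vanishing_on_secants_eq0], the easy half of the lemma of Terracini): the
partial derivatives of f vanish at every secant point as well, so an induction
on the degree applies, and in characteristic 0 a polynomial with zero
derivatives is constant.

Genericity is handled throughout by polynomial functions of one variable, by
joining points with lines or with a monomial curve in Y; over an infinite field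
two conditions that each hold outside a finite set hold together somewhere. *)

Set Implicit Arguments.
Unset Strict Implicit.
Unset Printing Implicit Defensive.

Import GRing.Theory.
Import VectorInternalTheory.

Local Open Scope ring_scope.

(** * Polynomial conditions in one variable *)

Section OneVariable.
Variable F : fieldType.

Definition polyfun (f : F -> F) := exists q : {poly F}, forall t, f t = q.[t].

Lemma eq_polyfun f g : f =1 g -> polyfun f -> polyfun g.
Proof. by move=> fg [q fE]; exists q => t; rewrite -fg fE. Qed.

Lemma polyfun_const c : polyfun (fun=> c).
Proof. by exists c%:P => t; rewrite hornerC. Qed.

Lemma polyfun_id : polyfun id.
Proof. by exists 'X => t; rewrite hornerX. Qed.

Lemma polyfunD f g : polyfun f -> polyfun g -> polyfun (fun t => f t + g t).
Proof. by move=> [q fE] [r gE]; exists (q + r) => t; rewrite hornerD fE gE. Qed.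

Lemma polyfunM f g : polyfun f -> polyfun g -> polyfun (fun t => f t * g t).
Proof. by move=> [q fE] [r gE]; exists (q * r) => t; rewrite hornerM fE gE. Qed.

Lemma polyfunX f k : polyfun f -> polyfun (fun t => f t ^+ k).
Proof. by move=> [q fE]; exists (q ^+ k) => t; rewrite horner_exp fE. Qed.

Lemma polyfun_sum (I : Type) (r : seq I) (P : pred I) (f : I -> F -> F) :
  (forall i, polyfun (f i)) -> polyfun (fun t => \sum_(i <- r | P i) f i t).
Proof.
move=> fP; elim: r => [|i r IH].
  by apply: eq_polyfun (polyfun_const 0) => t; rewrite big_nil.
case Pi: (P i); last by apply: eq_polyfun IH => t; rewrite big_cons Pi.
by apply: eq_polyfun (polyfunD (fP i) IH) => t; rewrite big_cons Pi.
Qed.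

Lemma polyfun_prod (I : Type) (r : seq I) (P : pred I) (f : I -> F -> F) :
  (forall i, polyfun (f i)) -> polyfun (fun t => \prod_(i <- r | P i) f i t).
Proof.
move=> fP; elim: r => [|i r IH].
  by apply: eq_polyfun (polyfun_const 1) => t; rewrite big_nil.
case Pi: (P i); last by apply: eq_polyfun IH => t; rewrite big_cons Pi.
by apply: eq_polyfun (polyfunM (fP i) IH) => t; rewrite big_cons Pi.
Qed.

Lemma polyfun_det r (A : F -> 'M[F]_r) :
  (forall i j, polyfun (fun t => A t i j)) -> polyfun (fun t => \det (A t)).
Proof.
move=> AP; apply: polyfun_sum => s.
by apply: polyfunM; [exact: polyfun_const | exact: polyfun_prod].
Qed.

Lemma polyfun_meval N (v : F -> 'I_N -> F) (f : {mpoly F[N]}) :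
  (forall i, polyfun (v^~ i)) -> polyfun (fun t => f.@[v t]).
Proof.
move=> vP; apply: eq_polyfun (fun t => esym (mevalE (v t) f)) _.
apply: polyfun_sum => k; apply: polyfunM; first exact: polyfun_const.
by apply: polyfun_prod => i; apply: polyfunX.
Qed.

(** The finite exceptional set is contained in the roots of a nonzero
polynomial, which makes conjunctions products. *)
Definition cofinitely (Q : F -> Prop) :=
  exists2 q : {poly F}, q != 0 & forall t, q.[t] != 0 -> Q t.

Lemma cofinitelyT (Q : F -> Prop) : (forall t, Q t) -> cofinitely Q.
Proof. by move=> QT; exists 1; rewrite ?oner_neq0. Qed.

Lemma cofinitelyI (Q R : F -> Prop) :
  cofinitely Q -> cofinitely R -> cofinitely (fun t => Q t /\ R t).
Proof.
move=> [q q0 qQ] [r r0 rR]; exists (q * r); first by rewrite mulf_neq0.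
by move=> t; rewrite hornerM mulf_eq0 negb_or => /andP[/qQ ? /rR].
Qed.

Lemma cofinitely_all (T : eqType) (s : seq T) (Q : T -> F -> Prop) :
  (forall x, x \in s -> cofinitely (Q x)) ->
  cofinitely (fun t => forall x, x \in s -> Q x t).
Proof.
elim: s => [|x s IH] QP; first by apply: cofinitelyT.
have [||q q0 qQ] := @cofinitelyI (Q x) (fun t => forall x, x \in s -> Q x t).
- by apply: QP; rewrite mem_head.
- by apply: IH => y ys; apply: QP; rewrite inE ys orbT.
exists q => // t /qQ[Qx Qs] y; rewrite inE => /predU1P[->|] //; exact: Qs.
Qed.

Lemma cofinitely_neq0 f t0 :
  polyfun f -> f t0 != 0 -> cofinitely (fun t => f t != 0).
Proof.
move=> [q fE] ft0; exists q; last by move=> t; rewrite fE.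
by apply: contraNneq ft0 => q0; rewrite fE q0 horner0.
Qed.

Hypothesis F_char0 : [pchar F] =i pred0.

Lemma natr_inj_char0 : injective (fun k : nat => k%:R : F).
Proof.
suff natr_leq a b : a%:R = b%:R :> F -> (a <= b)%N.
  by move=> a b ab; apply/eqP; rewrite eqn_leq !natr_leq.
move=> ab; rewrite leqNgt; apply/negP => ba.
have: (a - b)%:R == 0 :> F by rewrite natrB ?ab ?subrr // ltnW.
by rewrite (pcharf0P F).1 // subn_eq0 leqNgt ba.
Qed.

Lemma cofinitely_ex Q : cofinitely Q -> exists t, Q t.
Proof.
move=> [q q0 qQ]; pose s := [seq k%:R : F | k <- iota 0 (size q)].
have us : uniq s by rewrite map_inj_uniq ?iota_uniq //; exact: natr_inj_char0.
have /allPn[t _ /qQ Qt] : ~~ all (root q) s.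
  apply/negP => /(max_poly_roots q0)/(_ us).
  by rewrite size_map size_iota ltnn.
by exists t.
Qed.

(** The one-variable form of the density of nonempty open sets. *)
Lemma polyfun_eq0 f t :
  polyfun f -> cofinitely (fun t => f t = 0) -> f t = 0.
Proof.
move=> fP f0; apply/eqP/negP => /negP ft.
have /cofinitely_ex[u [fu /eqP]] := cofinitelyI f0 (cofinitely_neq0 fP ft).
by rewrite fu.
Qed.

End OneVariable.

(** * Ranks and minors *)

Section Rank.
Variable F : fieldType.

Lemma nonzero_minor p q (M : 'M[F]_(p, q)) :
  exists (f : 'I_(\rank M) -> 'I_p) (g : 'I_(\rank M) -> 'I_q),
    \det (mxsub f g M) != 0.
Proof.
have rM : row_full (rowsub (maxrankfun M) M)^T.
  by rewrite /row_full mxrank_tr; have := maxrowsub_free M.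
exists (maxrankfun M), (fullrankfun rM).
have := fullrowsub_unit rM; rewrite unitmxE -det_tr unitfE.
by congr (\det _ != 0); apply/matrixP=> i j; rewrite !mxE.
Qed.

Lemma minor_rank p q r (M : 'M[F]_(p, q))
    (f : 'I_r -> 'I_p) (g : 'I_r -> 'I_q) :
  \det (mxsub f g M) != 0 -> (r <= \rank M)%N.
Proof.
rewrite -unitfE -unitmxE => /mxrank_unit <-.
have -> : mxsub f g M = rowsub f 1%:M *m (M *m colsub g 1%:M).
  by rewrite mulmx_colsub mulmx1 -rowsubE; apply/matrixP => i j; rewrite !mxE.
by rewrite (leq_trans (mxrankM_maxr _ _)) // mxrankM_maxl.
Qed.

(** A minor that is nonzero at [t0] is a nonzero polynomial in [t]. *)
Lemma rank_semicontinuous p q (M : F -> 'M[F]_(p, q)) t0 :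
  (forall i j, polyfun (fun t => M t i j)) ->
  cofinitely (fun t => (\rank (M t0) <= \rank (M t))%N).
Proof.
move=> MP; have [f [g minor0]] := nonzero_minor (M t0).
have minorP : polyfun (fun t => \det (mxsub f g (M t))).
  apply: polyfun_det => i j; apply: eq_polyfun (MP (f i) (g j)) => t.
  by rewrite mxE.
have [q' q'0 q'P] := cofinitely_neq0 minorP minor0.
by exists q' => // t /q'P/minor_rank.
Qed.

End Rank.

(** * Spans in a space of functions on a finite set *)

Section Family.
Variables (F : fieldType) (I : finType).
Local Notation V := {ffun I -> F^o}.

Definition delta_fun (i : I) : V := [ffun j => (i == j)%:R].

Lemma delta_fun_sum (x : V) : x = \sum_i x i *: delta_fun i.
Proof.
apply/ffunP => j; rewrite sum_ffunE (bigD1 j) //= !ffunE eqxx [_ *: _]mulr1.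
by rewrite big1 ?addr0 // => i /negPf ij; rewrite !ffunE ij [_ *: _]mulr0.
Qed.

Lemma dim_ffun : \dim {:V} = #|I|.
Proof. by rewrite dimvf /dim /= muln1. Qed.

Variable J : finType.

(** Dimensions in [{ffun I -> F^o}] are defined through an abstract choice of
coordinates; this matrix holds the values themselves, so that its minors are
polynomials in them. *)
Definition coordmx (g : J -> V) : 'M[F]_(#|J|, #|I|) :=
  \matrix_(x, l) g (enum_val x) (enum_val l).

Lemma dim_family (g : J -> V) : \dim (\sum_x <[g x]>) = \rank (coordmx g).
Proof.
(* Q changes the values of a function into the abstract coordinates. *)
pose Q : 'M[F]_(#|I|, dim V) := \matrix_l v2r (delta_fun (enum_val l)).
have mulQ (w : 'rV_#|I|) :
    w *m Q = v2r (\sum_l w 0 l *: delta_fun (enum_val l)).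
  rewrite mulmx_sum_row linear_sum; apply: eq_bigr => l _.
  by rewrite rowK linearZ.
have Qfree : row_free Q.
  apply: inj_row_free => w; rewrite mulQ => w0.
  have {w0} /ffunP w0 : \sum_l w 0 l *: delta_fun (enum_val l) = 0.
    by apply: v2r_inj; rewrite w0 linear0.
  apply/rowP => l; have := w0 (enum_val l).
  rewrite sum_ffunE (bigD1 l) //= !ffunE eqxx [_ *: _]mulr1 big1 ?addr0 ?mxE //.
  move=> l' /negPf ll'; rewrite !ffunE (inj_eq enum_val_inj) ll'.
  exact: mulr0.
have rowQ x : row x (coordmx g *m Q) = v2r (g (enum_val x)).
  rewrite row_mul mulQ; congr (v2r _).
  rewrite [RHS]delta_fun_sum [RHS](reindex _ (onW_bij _ (enum_val_bij _))) /=.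
  by apply: eq_bigr => l _; rewrite !mxE.
have -> : (\sum_x <[g x]>)%VS = mx2vs (coordmx g *m Q).
  apply/eqP; rewrite eqEsubv; apply/andP; split.
    apply/subv_sumP => x _; rewrite /subsetv !mx2vsK.
    by rewrite -(enum_rankK x) -rowQ row_sub.
  rewrite /subsetv mx2vsK; apply/row_subP => x; rewrite rowQ.
  have := sumv_sup (enum_val x) (P := predT) (U := <[g (enum_val x)]>%VS)
    (Vs := fun x => <[g x]>%VS) isT (subvv _).
  by rewrite /subsetv mx2vsK.
by rewrite /dimv mx2vsK mxrankMfree.
Qed.

End Family.

Lemma dim_delta_family (F : fieldType) (I K : finType) (h : K -> I)
    (W : {vspace {ffun I -> F^o}}) :
  injective h -> (forall x, delta_fun F (h x) \in W) -> (#|K| <= \dim W)%N.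
Proof.
move=> h_inj hW.
have /dimvS : (\sum_x <[delta_fun F (h x)]> <= W)%VS.
  by apply/subv_sumP => x _; rewrite -memvE.
apply: leq_trans; rewrite dim_family.
apply: (@minor_rank _ _ _ _ _ id (fun x => enum_rank (h (enum_val x)))).
rewrite (_ : mxsub _ _ _ = 1%:M) ?det1 ?oner_neq0 //.
apply/matrixP => x y; rewrite !mxE !ffunE enum_rankK (inj_eq h_inj).
by rewrite (inj_eq enum_val_inj).
Qed.

(** * The affine tangent space of the Segre variety *)

Section Tangent.
Variables (F : fieldType) (k : nat) (n : 'I_k -> nat).
Local Notation factor := (factor F n).
Local Notation mindex := (mindex n).
Local Notation tensor := (tensor F n).
Implicit Types v : forall i, factor i.

Definition coord_index : finType := {i : 'I_k & 'I_(n i).+1}.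

Definition tgen v (x : coord_index) : tensor :=
  ptensor_at v (delta_mx 0 (tagged x)).

Lemma ptensor_atE v i (w : factor i) l :
  ptensor_at v w l = w 0 (l i) * \prod_(i' | i' != i) v i' 0 (l i').
Proof.
rewrite ffunE (bigD1 i) //= dfwith_in; congr (_ * _).
by apply: eq_bigr => i' i'i; rewrite dfwith_out // eq_sym.
Qed.

Lemma ptensor_at_id v i : ptensor_at v (v i) = ptensor v.
Proof. by apply/ffunP => l; rewrite ptensor_atE ffunE [RHS](bigD1 i). Qed.

Lemma ptensor_at_delta v i (w : factor i) :
  ptensor_at v w = \sum_j w 0 j *: ptensor_at v (delta_mx 0 j : factor i).
Proof.
rewrite {1}(row_sum_delta w). rewrite linear_sum. apply: eq_bigr => j _.
by rewrite linearZ.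
Qed.

Lemma tangent_tgen v : tangent v = (\sum_x <[tgen v x]>)%VS.
Proof.
rewrite /tangent /tgen.
rewrite -(sig_big_dep predT (fun=> predT)
  (fun i j => <[ptensor_at v (delta_mx 0%R j : factor i)]>%VS)) /=.
apply: eq_bigr => i _; apply/eqP; rewrite eqEsubv; apply/andP; split.
  apply/subvP => _ /memv_imgP[w _ ->]; rewrite lfunE /= ptensor_at_delta.
  by apply: memv_sumr => j _; rewrite rpredZ ?memv_line.
apply/subv_sumP => j _; rewrite -memvE.
by rewrite -[X in X \in _](lfunE (@ptensor_at _ _ _ v i)) memv_img ?memvf.
Qed.

Lemma tgen_polyfun (v : F -> forall i, factor i) (x : coord_index) l :
  (forall i j, polyfun (fun t => v t i 0 j)) ->
  polyfun (fun t => tgen (v t) x l).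
Proof.
move=> vP.
apply: (@eq_polyfun _ (fun t => (delta_mx 0 (tagged x) : factor (tag x)) 0
    (l (tag x)) * \prod_(i | i != tag x) v t i 0 (l i))) => [t|].
  by rewrite /tgen ptensor_atE.
apply: polyfunM; first exact: polyfun_const.
by apply: polyfun_prod => i; exact: vP.
Qed.

Lemma mem_tangent v i (w : factor i) : ptensor_at v w \in tangent v.
Proof.
have := memv_img (linfun (@ptensor_at _ _ _ v i)) (memvf w).
rewrite lfunE; apply: subvP.
exact: (sumv_sup i (P := predT) (Vs := fun i => limg _)).
Qed.

Lemma card_mindex : #|{: mindex}| = (\prod_i (n i).+1)%N.
Proof.
rewrite card_dep_ffun foldrE big_map big_enum /=.
by apply: eq_bigr => i _; rewrite card_ord.
Qed.

Lemma dim_tensor : \dim {:tensor} = (\prod_i (n i).+1)%N.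
Proof. by rewrite dim_ffun card_mindex. Qed.

Lemma ptensor_neq0 v : (forall i, v i != 0) -> ptensor v != 0.
Proof.
move=> v0.
have /fin_all_exists[l lP] i : exists j, v i 0 j != 0.
  by have /rV0Pn[j] := v0 i; exists j.
apply/negP => /eqP/ffunP/(_ [ffun i => l i]) /eqP.
rewrite !ffunE => /prodf_eq0[i _]; rewrite ffunE; exact/negP.
Qed.

(** The k summands of the tangent space, of dimensions n_i + 1, all contain the
line of the point itself. *)
Lemma dim_tangent_le v :
  (forall i, v i != 0) -> (\dim (tangent v) <= 1 + \sum_i n i)%N.
Proof.
move=> v0; set L := fun i => limg (linfun (@ptensor_at _ _ _ v i)).
have dimL i : (\dim (L i) <= (n i).+1)%N.
  have := limg_ker_dim (linfun (@ptensor_at _ _ _ v i)) fullv.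
  by rewrite dimvf dim_matrix mul1r => <-; rewrite leq_addl.
have vL i : (<[ptensor v]> <= L i)%VS.
  rewrite -memvE -(ptensor_at_id v i).
  by rewrite -[X in X \in _](lfunE (@ptensor_at _ _ _ v i)) memv_img ?memvf.
have /dimvS : (tangent v <= <[ptensor v]> + \sum_i (L i :\: <[ptensor v]>))%VS.
  apply/subv_sumP => i _; rewrite -/(L i).
  rewrite -[X in (X <= _)%VS](addv_diff_cap (L i) <[ptensor v]>) addvC.
  rewrite addvS ?capvSr //.
  exact: (sumv_sup i (P := predT) (Vs := fun i => (L i :\: <[ptensor v]>)%VS)).
move/leq_trans; apply; apply: leq_trans (dimv_add_leqif _ _) _.
rewrite dim_vline ptensor_neq0 // leq_add2l.
apply: leq_trans (dimv_leq_sum _ _ _) _; apply: leq_sum => i _.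
have := dimv_cap_compl (L i) <[ptensor v]>.
rewrite (capv_idPr (vL i)) dim_vline ptensor_neq0 // add1n => dimLi.
by rewrite -ltnS dimLi.
Qed.

(** At a coordinate point the tangent space contains the basis tensors whose
multi-index differs from that of the point in at most one place. *)
Lemma dim_tangent_coordinate_point v (i0 : 'I_k) :
  (forall i j, v i 0 j = (j == 0)%:R) -> (1 + \sum_i n i <= \dim (tangent v))%N.
Proof.
move=> vE; pose z i : 'I_(n i).+1 := 0.
pose h (o : option {i : 'I_k & 'I_(n i)}) : mindex :=
  if o is Some x then [ffun i => dfwith z (lift ord0 (tagged x)) i]
  else [ffun i => z i].
have h_inj : injective h.
  move=> [[i j]|] [[i' j']|] //= /ffunP E.
  - have := E i; rewrite !ffunE dfwith_in /=.
    case: (eqVneq i' i) => [ii'|ii']; last by rewrite dfwith_out.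
    by subst i'; rewrite dfwith_in => /lift_inj ->.
  - by have := E i; rewrite !ffunE dfwith_in.
  - by have := E i'; rewrite !ffunE dfwith_in.
have card_h : #|{: option {i : 'I_k & 'I_(n i)}}| = (1 + \sum_i n i)%N.
  rewrite card_option card_tagged sumnE big_map big_enum /= add1n.
  by congr _.+1; apply: eq_bigr => i _; rewrite card_ord.
have hv i (j : 'I_(n i).+1) :
    delta_fun F ([ffun i => dfwith z j i] : mindex) \in tangent v.
  suff -> : delta_fun F ([ffun i => dfwith z j i] : mindex)
      = ptensor_at v (delta_mx 0 j : factor i).
    exact: mem_tangent.
  apply/ffunP => l; rewrite ptensor_atE !ffunE mxE eqxx /=.
  case: eqVneq => [<-|].
    rewrite ffunE dfwith_in eqxx mul1r big1 // => i' ii'.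
    by rewrite ffunE dfwith_out 1?eq_sym // vE eqxx.
  case: (eqVneq (l i) j) => [<- lE|_ _]; last by rewrite mul0r.
  rewrite mul1r; apply/esym/eqP/prodf_eq0.
  have [i' li'] : exists i', l i' != dfwith z (l i) i'.
    apply/existsP; apply: contraNT lE; rewrite negb_exists => /forallP lE.
    by apply/eqP/ffunP => i'; rewrite ffunE (eqP (negPn (lE i'))).
  case: (eqVneq i i') li' => [<-|ii']; first by rewrite dfwith_in eqxx.
  rewrite dfwith_out // => li'; exists i'; first by rewrite eq_sym.
  by rewrite vE (negPf li').
rewrite -card_h; apply: dim_delta_family h_inj _ => -[[i j]|] /=.
  exact: hv.
suff -> : [ffun i => z i] = [ffun i => dfwith z (z i0) i] :> mindex.
  exact: hv.
by apply/ffunP => i; rewrite !ffunE; case: dfwithP.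
Qed.

End Tangent.

(** * The Jacobian and the openness of the expected dimension *)

Section Homogeneity.
Variables (R : comNzRingType) (N : nat) (mf : measure N).

Lemma dhomog_bigprod (I : finType) (P : pred I) (f : I -> {mpoly R[N]}) d :
  (forall i, P i -> f i \is (d i).-homog for mf) ->
  \prod_(i | P i) f i \is (\sum_(i | P i) d i).-homog for mf.
Proof.
move=> fP; elim/big_ind2: _ => //; first exact: dhomog1.
by move=> x1 x2 y1 y2; exact: dhomogM.
Qed.

Lemma dhomog_det r (A : 'M[{mpoly R[N]}]_r) (d : 'I_r -> nat) :
  (forall i j, A i j \is (d i).-homog for mf) ->
  \det A \is (\sum_i d i).-homog for mf.
Proof.
move=> AP; apply: rpred_sum => s _; rewrite rpredMsign.
exact: dhomog_bigprod.
Qed.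

End Homogeneity.

Section Jacobian.
Variables (F : fieldType) (k : nat) (n : 'I_k -> nat) (s : nat).
Local Notation tensor := (tensor F n).
Local Notation hcoord := (hcoord n s).
Implicit Types p : rep_tuple F n s.

Definition hindex (a : 'I_s) (i : 'I_k) (j : 'I_(n i).+1) : 'I_#|hcoord| :=
  enum_rank ((a, Tagged (fun i => 'I_(n i).+1) j) : hcoord).

Section GroupDegree.
Variables (a : 'I_s) (i : 'I_k).

(** Degree in the homogeneous coordinates of one component of one point, as a
grading of the monomials: being multihomogeneous is being homogeneous for each
of these. *)
Definition group_degree (m : 'X_{1..#|hcoord|}) : nat :=
  \sum_(j < (n i).+1) m (hindex a j).

Lemma group_degree0 : group_degree 0%MM = 0%N.
Proof. by rewrite /group_degree big1 // => j _; rewrite mnm0E. Qed.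

Lemma group_degreeD :
  {morph group_degree : m1 m2 / (m1 + m2)%MM >-> (m1 + m2)%N}.
Proof.
by move=> m1 m2; rewrite /group_degree -big_split; apply: eq_bigr => j _;
  rewrite mnmDE.
Qed.

HB.instance Definition _ :=
  isMeasure.Build #|hcoord| group_degree group_degree0 group_degreeD.

Lemma group_degreeU a' i' (j' : 'I_(n i').+1) :
  group_degree U_(hindex a' j')%MM = (a' == a) && (i' == i).
Proof.
rewrite /group_degree; under eq_bigr do
  rewrite mnm1E (inj_eq enum_rank_inj) xpair_eqE.
have [_|aa'] := eqVneq a' a; last by rewrite big1.
case: (i' =P i) j' => [->|ii'] j' /=; last first.
  rewrite big1 // => j _; apply/eqP; rewrite eqb0.
  by apply/eqP => /(congr1 tag).
rewrite (bigD1 j') //= eqxx big1 // => j jj'.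
by apply/eqP; rewrite eqb0 eq_sym eq_Tagged.
Qed.

End GroupDegree.

Lemma multihomogeneous_of_dhomog (f : hpoly F n s) :
  (forall a i, exists d, f \is d.-homog for (group_degree a i)) ->
  multihomogeneous f.
Proof.
move=> fP a i; have [d /dhomogP fd] := fP a i.
by exists d => m /fd.
Qed.

Definition jac_poly (c : hcoord) (l : mindex n) : hpoly F n s :=
  if l (tag c.2) == tagged c.2
  then \prod_(i | i != tag c.2) 'X_(hindex c.1 (l i)) else 0.

Lemma jac_poly_eval p c l : hpoly_eval p (jac_poly c l) = tgen (p c.1) c.2 l.
Proof.
case: c => a [i j].
rewrite /hpoly_eval /jac_poly /tgen ptensor_atE /= mxE eqxx /=.
case: eqP => _; last by rewrite meval0 mul0r.
rewrite rmorph_prod mul1r; apply: eq_bigr => i' _ /=.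
by rewrite mevalXU /hcoord_val enum_rankK.
Qed.

(** The degree of an entry depends on its row only, so that minors are
multihomogeneous. *)
Lemma jac_poly_homog a i c l :
  jac_poly c l \is
    (\sum_(i' | i' != tag c.2) ((c.1 == a) && (i' == i))).-homog
    for (group_degree a i).
Proof.
rewrite /jac_poly; case: ifP => _; last exact: dhomog0.
apply: dhomog_bigprod => i' _.
by rewrite dhomogX; apply/eqP/group_degreeU.
Qed.

Definition jac_minor r (f : 'I_r -> 'I_#|hcoord|)
    (g : 'I_r -> 'I_#|{: mindex n}|) : hpoly F n s :=
  \det (\matrix_(x, y) jac_poly (enum_val (f x)) (enum_val (g y))).

Lemma jac_minor_multihomogeneous r (f : 'I_r -> _) g :
  multihomogeneous (jac_minor f g).
Proof.
apply: multihomogeneous_of_dhomog => a i; eexists; apply: dhomog_det => x y.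
by rewrite mxE; apply: jac_poly_homog.
Qed.

Definition jacobian p := coordmx (fun c : hcoord => tgen (p c.1) c.2).

Lemma jac_minor_eval r (f : 'I_r -> _) g p :
  hpoly_eval p (jac_minor f g) = \det (mxsub f g (jacobian p)).
Proof.
rewrite /hpoly_eval -det_map_mx; congr (\det _); apply/matrixP => x y.
by rewrite !mxE -jac_poly_eval.
Qed.

Definition tangent_sum p : {vspace tensor} := (\sum_a tangent (p a))%VS.

Lemma dim_tangent_sum p : \dim (tangent_sum p) = \rank (jacobian p).
Proof.
rewrite -dim_family; congr (\dim _); rewrite /tangent_sum.
under eq_bigr do rewrite tangent_tgen.
by rewrite pair_big.
Qed.

Lemma dim_tangent_sum_le p : is_rep_tuple p ->
  (\dim (tangent_sum p) <= minn (s * (1 + \sum_i n i)) (\prod_i (n i).+1))%N.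
Proof.
move=> p0; rewrite leq_min -[X in _ && (_ <= X)%N](dim_tensor F).
rewrite dimvS ?subvf // andbT.
apply: leq_trans (dimv_leq_sum _ _ _) _.
rewrite -[X in (X * _)%N]card_ord -sum_nat_const; apply: leq_sum => a _.
exact: dim_tangent_le.
Qed.

(** The dimension never exceeds the expected one, so a minor of the Jacobian of
that size, nonzero at [p], defines an open set where the dimension is the
expected one. *)
Lemma T_true_from_point p : is_rep_tuple p ->
  (minn (s * (1 + \sum_i n i)) (\prod_i (n i).+1) <= \dim (tangent_sum p))%N ->
  T_true F n s.
Proof.
move=> p0 dim_p.
(* Any equation that forces the expected dimension may be used; the minor shows
   that the resulting open set is not empty. *)
pose S (f : hpoly F n s) := multihomogeneous f /\ forall q, is_rep_tuple q ->
  hpoly_eval q f != 0 -> \dim (tangent_sum q)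
    = minn (s * (1 + \sum_i n i)) (\prod_i (n i).+1).
exists (fun q => exists f, S f /\ hpoly_eval q f != 0); split.
- by exists S; split => // f [].
- exists p; split => //; have [f [g minor0]] := nonzero_minor (jacobian p).
  exists (jac_minor f g); split; last by rewrite jac_minor_eval.
  split=> [|q q0]; first exact: jac_minor_multihomogeneous.
  rewrite jac_minor_eval => /minor_rank; rewrite -!dim_tangent_sum => le_dim.
  apply/eqP; rewrite eqn_leq dim_tangent_sum_le //.
  exact: leq_trans le_dim.
- by move=> q q0 [f [[_ Sf] /Sf]]; apply.
Qed.

End Jacobian.

(** * Points in general position on a curve *)

Section GenericPoints.
Variables (F : fieldType) (F_char0 : [pchar F] =i pred0) (V : vectType F).
Variables (u : F -> V) (T : F -> {vspace V}).
Hypothesis u_avoids : forall W,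
  W != fullv -> cofinitely (fun t => u t \notin W).
Hypothesis T_semicontinuous : forall W t0,
  cofinitely (fun t => (\dim (W + T t0) <= \dim (W + T t))%N).
Local Notation P := (\dim (fullv : {vspace V})).

Lemma dim_add_line (W : {vspace V}) v r :
  (W != fullv -> v \notin W) -> (minn P r <= \dim W)%N ->
  (minn P r.+1 <= \dim (W + <[v]>))%N.
Proof.
move=> vW leW; have [Wf|Wf] := eqVneq W fullv.
  by rewrite geq_min dimvS // Wf addvSl.
have /ltn_leqif ltW := dimv_leqif_sup (addvSl W <[v]>).
have {ltW} : (\dim W < \dim (W + <[v]>))%N.
  rewrite ltW; apply: contraNN (vW Wf) => /subvP; apply.
  by rewrite memvE addvSr.
apply: leq_trans; case: (leqP P r) leW => [Pr|rP] leW.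
  rewrite geq_min (leq_trans _ (ltnW (ltnSn _))) //.
by rewrite geq_min ltnS leW orbT.
Qed.

(** The points are chosen one after the other.  A new point must satisfy the
condition on its own tangent space with respect to all earlier points; to keep
that possible, the condition is maintained along the way for the reserve
parameter [t0], from which it spreads to almost all [t] by semicontinuity. *)
Lemma generic_points d t0 s : (d < \dim (T t0))%N ->
  exists ts : s.-tuple F, let U := <<[seq u t | t <- ts]>>%VS in
    (minn P s <= \dim U)%N /\
    forall t, t \in ts -> (minn P (s + d) <= \dim (U + T t))%N.
Proof.
move=> dT.
suff [ts [? ? _]] : exists ts : s.-tuple F,
    let U := <<[seq u t | t <- ts]>>%VS in
    [/\ (minn P s <= \dim U)%N,
        forall t, t \in ts -> (minn P (s + d) <= \dim (U + T t))%N
      & (minn P (s.+1 + d) <= \dim (U + T t0))%N] by exists ts.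
elim: s => [|s [ts [dimU dimUts dimUt0]]].
  exists [tuple]; split; rewrite //= ?minn0 //.
  by rewrite span_nil add0v geq_min dT orbT.
move: dimU dimUts dimUt0; set U := <<_>>%VS => dimU dimUts dimUt0.
have avoid W : cofinitely (fun t => W != fullv -> u t \notin W).
  case: (eqVneq W fullv) => [_|/u_avoids[q q0 qu]]; first exact: cofinitelyT.
  by exists q => // t /qu.
have /(cofinitely_ex F_char0)[t [[tU tUt0] [tUts tUT]]] :=
  cofinitelyI (cofinitelyI (avoid U) (avoid (U + T t0)%VS))
   (cofinitelyI (cofinitely_all (fun t' (_ : t' \in (ts : seq F)) =>
      avoid (U + T t')%VS)) (T_semicontinuous U t0)).
exists [tuple of t :: ts]; rewrite /= span_cons -/U addvC; split.
- exact: dim_add_line.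
- move=> t'; rewrite inE => /predU1P[->|t'ts].
    apply: leq_trans (leq_trans dimUt0 tUT) _.
    by rewrite dimvS // -addvA addvS // addvSr.
  rewrite -addvA (addvC <[u t]>%VS) addvA.
  by apply: dim_add_line; [exact: tUts | exact: dimUts].
- by rewrite -addvA (addvC <[u t]>%VS) addvA; apply: dim_add_line.
Qed.

End GenericPoints.

Section Curve.
Variables (F : fieldType) (k : nat) (n : 'I_k -> nat) (c : 'I_k -> nat).
Local Notation factor := (factor F n).
Local Notation mindex := (mindex n).
Local Notation tensor := (tensor F n).

(** A monomial curve in the Segre variety: if the weights of the multi-indices
are different, its coordinates are different powers of [t], hence it spans the
whole space.  For positive [c] it passes at [t = 0] through a coordinate
point. *)
Definition curve (t : F) (i : 'I_k) : factor i := \row_j t ^+ (c i * j).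

Definition weight (l : mindex) : nat := \sum_i c i * l i.

Lemma curve_neq0 t i : curve t i != 0.
Proof.
apply/rV0Pn; exists 0; rewrite mxE muln0 expr0; exact: oner_neq0.
Qed.

Lemma ptensor_curve t l : ptensor (curve t) l = t ^+ weight l.
Proof. by rewrite ffunE -prodrXr; apply: eq_bigr => i _; rewrite mxE. Qed.

(** A linear form vanishing on [W] becomes a polynomial in [t] on the curve, and
its coefficients are those of the form. *)
Lemma curve_avoids (W : {vspace tensor}) :
  injective weight -> W != fullv ->
  cofinitely (fun t => ptensor (curve t) \notin W).
Proof.
move=> w_inj Wf.
have [l0 l0W] : exists l0, delta_fun F l0 \notin W.
  apply/existsP; apply: contraNT Wf; rewrite negb_exists => /forallP lW.
  rewrite eqEsubv subvf /=.
  apply/subvP => x _; rewrite (delta_fun_sum x) rpred_sum // => l _.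
  by rewrite rpredZ //; exact: negPn (lW l).
(* A coordinate of f is the linear form; the kernel of f is W. *)
pose f x := x - projv W x.
have [b fb] : exists b, f (delta_fun F l0) b != 0.
  apply/existsP; apply: contraNT l0W; rewrite negb_exists => /forallP fb.
  have : f (delta_fun F l0) = 0.
    by apply/ffunP => b; rewrite (eqP (negPn (fb b))) ffunE.
  by move/eqP; rewrite subr_eq0 => /eqP->; rewrite memv_proj.
pose q := \sum_l f (delta_fun F l) b *: 'X^(weight l).
exists q.
  apply: contraNneq fb => /(congr1 (coefp (weight l0))) /=.
  rewrite coef0 coef_sum (bigD1 l0) //= coefZ coefXn eqxx mulr1.
  rewrite big1 ?addr0 => [->//|l /negPf ll0].
  by rewrite coefZ coefXn (inj_eq w_inj) eq_sym ll0 mulr0.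
move=> t; apply: contraNN => uW.
have : f (ptensor (curve t)) b = 0 by rewrite /f projv_id // subrr ffunE.
rewrite [X in f X]delta_fun_sum /f linear_sum -sumrB sum_ffunE => <-.
rewrite /q horner_sum; apply/eqP; apply: eq_bigr => l _.
by rewrite linearZ -scalerBr hornerZ hornerXn ptensor_curve !ffunE mulrC.
Qed.

Lemma curve_tangent_semicontinuous (W : {vspace tensor}) t0 :
  cofinitely (fun t =>
    (\dim (W + tangent (curve t0)) <= \dim (W + tangent (curve t)))%N).
Proof.
pose g t (x : 'I_(\dim W) + coord_index n) : tensor :=
  match x with inl i => (vbasis W)`_i | inr y => tgen (curve t) y end.
have gE t : (W + tangent (curve t) = \sum_x <[g t x]>)%VS.
  rewrite big_sumType /= tangent_tgen; congr (_ + _)%VS.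
  rewrite -[LHS](span_basis (vbasisP W)) span_def (big_nth 0) size_tuple.
  exact: big_mkord.
have [q q0 qP] : cofinitely (fun t =>
    (\rank (coordmx (g t0)) <= \rank (coordmx (g t)))%N).
  apply: rank_semicontinuous => x l.
  apply: (@eq_polyfun _ (fun t => g t (enum_val x) (enum_val l))) => [t|].
    by rewrite mxE.
  case: (enum_val x) => [i|y]; first exact: polyfun_const.
  apply: tgen_polyfun => i j.
  by apply: eq_polyfun (polyfunX (c i * j) (polyfun_id F)) => t; rewrite mxE.
by exists q => // t /qP; rewrite -!dim_family -!gE.
Qed.

Lemma generic_curve_points s (i0 : 'I_k) : [pchar F] =i pred0 ->
  injective weight -> (forall i, 0 < c i)%N ->
  let P := (\prod_i (n i).+1)%N in
  exists ts : s.-tuple F,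
    let U := <<[seq ptensor (curve t) | t <- ts]>>%VS in
    (minn P s <= \dim U)%N /\
    forall t, t \in ts ->
      (minn P (s + \sum_i n i) <= \dim (U + tangent (curve t)))%N.
Proof.
move=> F_char0 w_inj c_gt0 P; rewrite /P -(dim_tensor F n).
have select := @generic_points _ F_char0 tensor (fun t => ptensor (curve t))
  (fun t => tangent (curve t)).
apply: (select (fun W => @curve_avoids W w_inj)
  curve_tangent_semicontinuous _ 0).
rewrite -add1n; apply: dim_tangent_coordinate_point i0 _.
move=> i j; rewrite mxE expr0n muln_eq0.
by rewrite -[c i == 0%N]negbK -lt0n c_gt0.
Qed.

End Curve.

Lemma base_digits_inj R m (f g : nat -> nat) :
  (forall i, f i < R)%N -> (forall i, g i < R)%N ->
  (\sum_(i < m) R ^ i * f i = \sum_(i < m) R ^ i * g i)%N ->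
  forall i, (i < m)%N -> f i = g i.
Proof.
elim: m f g => [//|m IH] f g fR gR.
have split (h : nat -> nat) : (\sum_(i < m.+1) R ^ i * h i =
    (\sum_(i < m) R ^ i * h i.+1) * R + h 0)%N.
  rewrite big_ord_recl /= mul1n addnC; congr (_ + _)%N.
  rewrite big_distrl; apply: eq_bigr => i _ /=.
  by rewrite /bump add1n expnS -mulnA mulnC.
have R_gt0 : (0 < R)%N by apply: leq_ltn_trans (fR 0%N).
rewrite !split => E.
have E0 : f 0%N = g 0%N.
  by move/(congr1 (modn^~ R)): E; rewrite !modnMDl !modn_small.
move: E; rewrite E0 => /addIn/eqP; rewrite eqn_pmul2r // => /eqP E [|i] //.
by rewrite ltnS => im; apply: (IH (f \o S) (g \o S)) => // j;
  [apply: fR | apply: gR].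
Qed.

(** Weights that read the multi-index as a number in base [R]. *)
Lemma weight_digits_inj k (n : 'I_k -> nat) R :
  (forall i, n i < R)%N -> injective (@weight k n (fun i => R ^ i)%N).
Proof.
move=> nR l l' E; apply/ffunP => i; apply: val_inj => /=.
have R_gt0 : (0 < R)%N by apply: leq_ltn_trans (nR i).
pose d (l : mindex n) j := if insub j is Some i then l i : nat else 0%N.
have dR l1 j : (d l1 j < R)%N.
  by rewrite /d; case: insubP => // i' _ _; apply: leq_trans (nR i').
have dE l1 (i' : 'I_k) : d l1 i' = l1 i' by rewrite /d valK.
rewrite -!dE; apply: (@base_digits_inj R k) (ltn_ord i); [exact: dR|exact: dR|].
by move: E; rewrite /weight; under eq_bigr do rewrite -dE;
  under [in RHS]eq_bigr do rewrite -dE.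
Qed.

(** * Splitting off the last factor *)

Lemma dim_limg_le (F : fieldType) (U V : vectType F) (f : 'Hom(U, V)) E :
  (\dim (f @: E) <= \dim E)%N.
Proof. by rewrite -(limg_ker_dim f E) leq_addl. Qed.

Section Extensionality.
Variables (F : fieldType) (k : nat) (n : 'I_k -> nat).
Implicit Types v : forall i, factor F n i.

Lemma eq_ptensor v v' : (forall i, v i = v' i) -> ptensor v = ptensor v'.
Proof.
move=> vv'; apply/ffunP => l; rewrite !ffunE.
by apply: eq_bigr => i _; rewrite vv'.
Qed.

Lemma eq_ptensor_at v v' i (w : factor F n i) :
  (forall i, v i = v' i) -> ptensor_at v w = ptensor_at v' w.
Proof.
move=> vv'; apply/ffunP => l; rewrite !ptensor_atE; congr (_ * _).
by apply: eq_bigr => j _; rewrite vv'.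
Qed.

Lemma eq_tangent v v' : (forall i, v i = v' i) -> tangent v = tangent v'.
Proof.
move=> vv'; rewrite !tangent_tgen; apply: eq_bigr => x _.
by rewrite /tgen (eq_ptensor_at _ vv').
Qed.

End Extensionality.

Section LastFactor.
Variables (F : fieldType) (m : nat) (n : 'I_m.+1 -> nat).

Definition init_dims (i : 'I_m) : nat := n (lift ord_max i).
Local Notation n' := init_dims.
Local Notation last_factor := (factor F n ord_max).
Implicit Types (v : forall i, factor F n i) (w : last_factor).

Definition init v (i : 'I_m) : factor F n' i := v (lift ord_max i).

Definition init_index (l : mindex n) : mindex n' :=
  [ffun i => l (lift ord_max i)].

(** [tens] is the tensor product of a tensor in the first factors with a vector
of the last one; [tensl] is the same with the arguments exchanged, so that both
partial applications can be given a linear structure. *)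
Definition tens (x : tensor F n') w : tensor F n :=
  [ffun l => x (init_index l) * w 0 (l ord_max)].

Definition tensl w x := tens x w.

Lemma tensl_is_linear w : linear (tensl w).
Proof.
by move=> a x y; apply/ffunP => l; rewrite !ffunE mulrDl -mulrA.
Qed.

HB.instance Definition _ w :=
  GRing.isLinear.Build F (tensor F n') (tensor F n) *:%R (tensl w)
    (@tensl_is_linear w).

Lemma tens_is_linear x : linear (tens x).
Proof.
move=> a y z; apply/ffunP => l; rewrite !ffunE !mxE mulrDr.
by congr (_ + _); rewrite mulrCA.
Qed.

HB.instance Definition _ x :=
  GRing.isLinear.Build F last_factor (tensor F n) *:%R (tens x)
    (@tens_is_linear x).

Lemma ptensor_tens v : ptensor v = tens (ptensor (init v)) (v ord_max).
Proof.
apply/ffunP => l; rewrite !ffunE (bigD1_ord ord_max) //= mulrC; congr (_ * _).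
by apply: eq_bigr => i _; rewrite ffunE.
Qed.

Lemma ptensor_at_last v w : ptensor_at v w = tens (ptensor (init v)) w.
Proof.
rewrite [LHS]ptensor_tens dfwith_in; congr (tens _ _).
by apply: eq_ptensor => i; rewrite /init dfwith_out // neq_lift.
Qed.

Lemma ptensor_at_init v i (w : factor F n (lift ord_max i)) :
  ptensor_at v w = tens (ptensor_at (init v) (w : factor F n' i)) (v ord_max).
Proof.
rewrite [LHS]ptensor_tens dfwith_out 1?eq_sym ?neq_lift //; congr (tens _ _).
apply: eq_ptensor => j; rewrite /init.
case: (eqVneq i j) => [<-|ij]; first by rewrite !dfwith_in.
by rewrite !dfwith_out // (inj_eq lift_inj).
Qed.

Lemma tangent_tens v :
  tangent v = (linfun (tensl (v ord_max)) @: tangent (init v)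
               + limg (linfun (tens (ptensor (init v)))))%VS.
Proof.
rewrite /tangent (bigD1_ord ord_max) //= addvC; congr (_ + _)%VS; last first.
  by apply: eq_in_limg => w _; rewrite !lfunE /= ptensor_at_last.
rewrite limg_sum; apply: eq_bigr => i _; rewrite -limg_comp.
apply: eq_in_limg => w _; rewrite comp_lfunE.
by rewrite !lfunE /= ptensor_at_init.
Qed.

Lemma prod_init_dims :
  (\prod_(i < m.+1 | i != ord_max) (n i).+1 = \prod_i (n' i).+1)%N.
Proof.
rewrite big_mkcond (bigD1_ord ord_max) //= eqxx /= mul1n; apply: eq_bigr => i _.
by rewrite eq_sym neq_lift.
Qed.

Lemma sum_init_dims :
  (\sum_(i < m.+1 | i != ord_max) n i = \sum_i n' i)%N.
Proof.
rewrite big_mkcond (bigD1_ord ord_max) //= eqxx /= add0n; apply: eq_bigr => i _.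
by rewrite eq_sym neq_lift.
Qed.

Lemma prod_dims :
  (\prod_i (n i).+1 = (\prod_i (n' i).+1) * (n ord_max).+1)%N.
Proof. by rewrite (bigD1_ord ord_max) //= mulnC. Qed.

Lemma sum_dims : (\sum_i n i = \sum_i n' i + n ord_max)%N.
Proof. by rewrite (bigD1_ord ord_max) //= addnC. Qed.

(** Gluing a multi-index with a last index; comparing cardinals avoids building
the dependent function. *)
Lemma index_exists (b : mindex n') (j : 'I_(n ord_max).+1) :
  exists l : mindex n, init_index l = b /\ l ord_max = j.
Proof.
pose h (l : mindex n) := (init_index l, l ord_max).
have h_inj : injective h.
  move=> l l' [/ffunP E1 E2]; apply/ffunP => i.
  case: (unliftP ord_max i) => [i' ->|-> //].
  by have := E1 i'; rewrite !ffunE.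
have /(inj_card_bij h_inj)[g _ hg] :
    (#|{: mindex n' * 'I_(n ord_max).+1}| <= #|{: mindex n}|)%N.
  by rewrite card_prod !card_mindex card_ord prod_dims.
by exists (g (b, j)); have [] := hg (b, j).
Qed.

(** The decomposition of the tensor space along the basis of the last factor. *)
Lemma dim_slices (S : 'I_(n ord_max).+1 -> {vspace tensor F n'}) :
  \dim (\sum_c (linfun (tensl (delta_mx 0%R c)) @: S c)%VS) =
  (\sum_c \dim (S c))%N.
Proof.
have tE c (x : tensor F n') l : linfun (tensl (delta_mx 0 c)) x l =
    x (init_index l) * (l ord_max == c)%:R.
  by rewrite lfunE /= ffunE mxE eqxx.
have /directvP -> /= :
    directv (\sum_c (linfun (tensl (delta_mx 0%R c)) @: S c)%VS).
  apply/directv_sum_independent => us usS us0 c _; apply/ffunP => l.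
  rewrite [RHS]ffunE; have [lc|lc] := eqVneq (l ord_max) c; last first.
    have [x _ ->] := memv_imgP (usS c isT).
    by rewrite tE (negPf lc) mulr0.
  have /ffunP/(_ l) := us0; rewrite sum_ffunE (bigD1 c) //= ffunE.
  rewrite big1 ?addr0 // => c' c'c; have [y _ ->] := memv_imgP (usS c' isT).
  by rewrite tE lc eq_sym (negPf c'c) mulr0.
apply: eq_bigr => c _; apply: limg_dim_eq; apply/eqP; rewrite -subv0.
apply/subvP => x; rewrite memv_cap memv_ker memv0 => /andP[_ /eqP/ffunP x0].
apply/eqP/ffunP => b; have [l [<- lc]] := index_exists b c.
by have := x0 l; rewrite tE lc eqxx mulr1 => ->; rewrite !ffunE.
Qed.


Lemma linfun_tensE x w : linfun (tens x) w = tens x w.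
Proof. by rewrite lfunE. Qed.

Lemma linfun_tenslE w x : linfun (tensl w) x = tens x w.
Proof. by rewrite lfunE. Qed.

Lemma sum_dims_split s A B : (s <= (n ord_max).+1)%N ->
  (\sum_(c < (n ord_max).+1) (if (c < s)%N then A else B)
    = s * A + ((n ord_max).+1 - s) * B)%N.
Proof.
move=> sN; rewrite -(big_mkord predT (fun c => if (c < s)%N then A else B)).
rewrite (big_cat_nat (leq0n s) sN) /=; congr (_ + _)%N.
  rewrite (eq_big_nat _ _ (F2 := fun=> A)) ?sum_nat_const_nat ?subn0 //.
  by move=> i /andP[_ ->].
rewrite (eq_big_nat _ _ (F2 := fun=> B)) ?sum_nat_const_nat //.
by move=> i /andP[si _]; rewrite ltnNge si.
Qed.

(** With distinct basis vectors as last components, the slice of the sum of the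
tangent spaces along such a vector is U + T_(u_a) Y, and U along each remaining
basis vector. *)
Lemma exists_large_tangent_sum s :
  [pchar F] =i pred0 -> (0 < m)%N -> (s <= (n ord_max).+1)%N ->
  let P := (\prod_i (n' i).+1)%N in
  exists p : rep_tuple F n s, is_rep_tuple p /\
    (s * minn P (s + \sum_i n' i) + ((n ord_max).+1 - s) * minn P s
      <= \dim (tangent_sum p))%N.
Proof.
move=> F_char0 m_gt0 sN P.
(* Base-R digits give the multi-indices different weights. *)
pose R := (\max_i n i).+1; pose c (i : 'I_m.+1) := (R ^ i)%N.
pose c' i := c (lift ord_max i).
have nR i : (n' i < R)%N by rewrite ltnS (leq_bigmax (lift ord_max i)).
have w_inj : injective (@weight m n' c').
  move=> l l' E; apply: (weight_digits_inj nR).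
  by move: E; rewrite /weight /c' /c; under eq_bigr do rewrite lift_max;
    under [in RHS]eq_bigr do rewrite lift_max.
have c_gt0 i : (0 < c' i)%N by rewrite expn_gt0.
have [ts [dimU dimUT]] :=
  generic_curve_points s (Ordinal m_gt0) F_char0 w_inj c_gt0.
set U := <<_>>%VS in dimU dimUT.
pose e (a : 'I_s) : last_factor := delta_mx 0 (widen_ord sN a).
pose p a := dfwith (curve n c (tnth ts a)) (e a).
have p_last a : p a ord_max = e a by rewrite /p dfwith_in.
have p_init a i : init (p a) i = curve n' c' (tnth ts a) i.
  by rewrite /init /p dfwith_out // neq_lift.
exists p; split=> [a i|].
  rewrite /p; case: dfwithP => [|i' _]; last exact: curve_neq0.
  by apply/rV0Pn; exists (widen_ord sN a); rewrite mxE !eqxx oner_neq0.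
pose S (c0 : 'I_(n ord_max).+1) : {vspace tensor F n'} :=
  if insub (c0 : nat) is Some a then (U + tangent (curve n' c' (tnth ts a)))%VS
  else U.
apply: (@leq_trans (\sum_c0 \dim (S c0))).
  rewrite -sum_dims_split //; apply: leq_sum => c0 _; rewrite /S.
  case: insubP => [a -> _|/negPf->]; last exact: dimU.
  by apply: dimUT; exact: mem_tnth.
rewrite -dim_slices; apply: dimvS; apply/subv_sumP => c0 _.
have UV : (linfun (tensl (delta_mx 0%R c0)) @: U <= tangent_sum p)%VS.
  rewrite limg_span; apply/span_subvP => _ /mapP[_ /mapP[t /tnthP[a ->] ->] ->].
  rewrite linfun_tenslE -(eq_ptensor (p_init a)) -ptensor_at_last.
  apply: subvP (mem_tangent _ _).
  exact: (sumv_sup a (P := predT) (Vs := fun a => tangent (p a)) isT (subvv _)).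
rewrite /S; case: insubP => [a _ ac0|//].
rewrite limgD subv_add UV /=.
apply: subv_trans (sumv_sup a (P := predT) (Vs := fun a => tangent (p a))
  isT (subvv _)).
rewrite tangent_tens p_last (eq_tangent (p_init a)).
rewrite (_ : e a = delta_mx 0 c0) ?addvSl //.
by congr (delta_mx _ _); apply: val_inj.
Qed.

(** The sum of the tangent spaces lies in A (x) W + U (x) C, where W is spanned
by the last components and C is a complement of W; w is the dimension of W. *)
Lemma dim_tangent_sum_flattening s (p : rep_tuple F n s) :
  exists w : nat, [/\ (w <= s)%N, (w <= (n ord_max).+1)%N &
    (\dim (tangent_sum p)
      <= w * (\prod_i (n' i).+1) + s * ((n ord_max).+1 - w))%N].
Proof.
pose W := (\sum_a <[p a ord_max]>)%VS; pose C := (W^C)%VS.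
have dim_last : \dim {:last_factor} = (n ord_max).+1.
  by rewrite dimvf dim_matrix mul1r.
exists (\dim W); split.
- apply: leq_trans (dimv_leq_sum _ _ _) _.
  rewrite -[X in (_ <= X)%N]card_ord -sum1_card; apply: leq_sum => a _.
  by rewrite dim_vline leq_b1.
- by apply: leq_trans (dimvS (subvf W)) _; rewrite dim_last.
pose TL := (\sum_(x < \dim W) limg (linfun (tensl (vbasis W)`_x)))%VS.
pose TR := (\sum_a linfun (tens (ptensor (init (p a)))) @: C)%VS.
have memTL x w : w \in W -> tens x w \in TL.
  move=> /coord_vbasis->; rewrite linear_sum rpred_sum // => i _.
  rewrite linearZ /= rpredZ //.
  apply: subvP (sumv_sup i (P := predT) (Vs := fun i : 'I_(\dim W) =>
    limg (linfun (tensl (vbasis W)`_i))) isT (subvv _)) _ _.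
  by rewrite -linfun_tenslE memv_img ?memvf.
have lastW a : p a ord_max \in W.
  by rewrite memvE (sumv_sup a (P := predT)
    (Vs := fun a => <[p a ord_max]>%VS)).
have /dimvS : (tangent_sum p <= TL + TR)%VS.
  apply/subv_sumP => a _; rewrite tangent_tens subv_add; apply/andP; split.
    apply: subv_trans (addvSl _ _); apply/subvP => _ /memv_imgP[x _ ->].
    by rewrite linfun_tenslE memTL.
  apply/subvP => _ /memv_imgP[w _ ->]; rewrite linfun_tensE.
  have : w \in (W + C)%VS by rewrite addv_complf memvf.
  case/memv_addP => w1 w1W [w2 w2C ->]; rewrite linearD /=.
  apply: memv_add; first exact: memTL.
  apply: subvP (sumv_sup a (P := predT)
    (Vs := fun a => linfun (tens (ptensor (init (p a)))) @: C)%VS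
    isT (subvv _)) _ _.
  by rewrite -linfun_tensE memv_img.
move/leq_trans; apply; apply: leq_trans (dimv_add_leqif _ _) _.
apply: leq_add.
  apply: leq_trans (dimv_leq_sum _ _ _) _.
  rewrite -[X in (X * _)%N]card_ord -sum_nat_const; apply: leq_sum => x _.
  by rewrite (leq_trans (dim_limg_le _ _)) // dim_tensor.
apply: leq_trans (dimv_leq_sum _ _ _) _.
rewrite -[X in (X * _)%N]card_ord -sum_nat_const; apply: leq_sum => a _.
by rewrite (leq_trans (dim_limg_le _ _)) // dimv_compl dim_last.
Qed.

End LastFactor.

(** * Derivatives of polynomials in characteristic 0 *)

Section Derivatives.
Variables (F : fieldType) (F_char0 : [pchar F] =i pred0) (N : nat).
Implicit Types (f : {mpoly F[N]}) (x g : 'I_N -> F).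

Lemma mpoly_ring_ind (P : {mpoly F[N]} -> Prop) :
  (forall c, P c%:MP) -> (forall i, P 'X_i) ->
  (forall f1 f2, P f1 -> P f2 -> P (f1 + f2)) ->
  (forall f1 f2, P f1 -> P f2 -> P (f1 * f2)) -> forall f, P f.
Proof.
move=> PC PX PD PM f; rewrite (mpolyE f).
apply: (big_ind P) => [||m _]; [by rewrite -(mpolyC0 N) | exact: PD |].
rewrite -mul_mpolyC; apply: (PM _ _) => //; rewrite mpolyXE_id.
apply: (big_ind P) => [||i _]; [by rewrite -(mpolyC1 N) | exact: PM |].
elim: (m i) => [|d IH]; first by rewrite expr0 -(mpolyC1 N).
by rewrite exprS; apply: PM.
Qed.

Definition dderiv f x g := \sum_i f^`M(i).@[x] * g i.

Lemma taylor_order1 f x g : exists2 r, polyfun r & forall e,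
  f.@[fun i => x i + e * g i] = f.@[x] + e * dderiv f x g + e ^+ 2 * r e.
Proof.
elim/mpoly_ring_ind: f =>
  [c|i|f1 f2 [r1 P1 E1] [r2 P2 E2]|f1 f2 [r1 P1 E1] [r2 P2 E2]].
- exists (fun=> 0) => [|e]; first exact: polyfun_const.
  rewrite !mevalC /dderiv big1 ?mulr0 ?addr0 // => i _.
  by rewrite mderivC meval0 mul0r.
- exists (fun=> 0) => [|e]; first exact: polyfun_const.
  rewrite !mevalXU mulr0 addr0 /dderiv (bigD1 i) //= big1 ?addr0.
    rewrite mderivX mnm1E eqxx scale1r -{1}[U_(i)%MM]add0m addmK.
    by rewrite mpolyX0 meval1 mul1r.
  by move=> j ji; rewrite mderivX mnm1E eq_sym (negPf ji) scale0r meval0 mul0r.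
- exists (fun e => r1 e + r2 e) => [|e]; first exact: polyfunD.
  have -> : dderiv (f1 + f2) x g = dderiv f1 x g + dderiv f2 x g.
    rewrite /dderiv -big_split; apply: eq_bigr => i _ /=.
    by rewrite mderivD mevalD mulrDl.
  rewrite !mevalD E1 E2; ring.
- set d1 := dderiv f1 x g in E1; set d2 := dderiv f2 x g in E2.
  exists (fun e => f1.@[x] * r2 e + d1 * d2 + r1 e * f2.@[x]
    + e * (d1 * r2 e + r1 e * d2) + e ^+ 2 * (r1 e * r2 e)) => [|e].
    have PC := @polyfun_const F; have PI := polyfun_id F.
    by do !(apply: polyfunD || apply: polyfunM || apply: polyfunX).
  have -> : dderiv (f1 * f2) x g = d1 * f2.@[x] + f1.@[x] * d2.
    rewrite /d1 /d2 /dderiv mulr_suml mulr_sumr -big_split.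
    apply: eq_bigr => i _ /=.
    by rewrite mderivM mevalD !mevalM; ring.
  rewrite !mevalM E1 E2; ring.
Qed.

(** The coefficient of degree 1 of a polynomial in [e] that vanishes on the
infinite field. *)
Lemma dderiv_eq0 f x g :
  (forall e, f.@[fun i => x i + e * g i] = 0) -> dderiv f x g = 0.
Proof.
move=> f0; have [r rP E] := taylor_order1 f x g.
have fx : f.@[x] = 0.
  by rewrite -(f0 0); apply: meval_eq => i; rewrite mul0r addr0.
suff : dderiv f x g + 0 * r 0 = 0 by rewrite mul0r addr0.
apply: (@polyfun_eq0 F F_char0 (fun e => dderiv f x g + e * r e)).
  apply: polyfunD; first exact: polyfun_const.
  by apply: polyfunM => //; exact: polyfun_id.
exists 'X; rewrite ?polyX_eq0 // => e; rewrite hornerX => e0.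
apply: (mulfI e0); rewrite mulr0 -[RHS](f0 e) E fx add0r mulrDr expr2 mulrA //.
Qed.

Lemma msize_mderiv f d i : (msize f <= d.+1)%N -> (msize f^`M(i) <= d)%N.
Proof.
move=> fd; rewrite msizeE; apply/bigmax_leqP_seq => k.
rewrite mcoeff_msupp mcoeff_deriv => fk _.
have /msize_mdeg_lt/leq_trans/(_ fd) : (k + U_(i))%MM \in msupp f.
  by rewrite mcoeff_msupp; apply: contraNneq fk => ->; rewrite mul0rn.
by rewrite mdegD mdeg1 addn1.
Qed.

Lemma mderiv_eq0_const f : (forall i, f^`M(i) = 0) -> f = (f@_0)%:MP.
Proof.
move=> f0; apply/mpolyP => k; rewrite mcoeffC.
have [<-|k0] := eqVneq 0%MM k; first by rewrite mulr1.
rewrite mulr0; have [i ki] : exists i, k i != 0%N.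
  apply/existsP; apply: contraNT k0; rewrite negb_exists => /forallP k0.
  by apply/eqP/mnmP => i; rewrite mnm0E (eqP (negPn (k0 i))).
have /(congr1 (mcoeff (k - U_(i))%MM)) := f0 i.
rewrite mcoeff_deriv mcoeff0 submK ?lep1mP // => /eqP.
by rewrite -mulr_natr mulf_eq0 (pcharf0P F).1 // orbF => /eqP.
Qed.

End Derivatives.

(** * Surjective differential implies dense image *)

Section Density.
Variables (F : fieldType) (F_char0 : [pchar F] =i pred0).
Variables (k : nat) (n : 'I_k -> nat) (s : nat).
Local Notation factor := (factor F n).
Local Notation tensor := (tensor F n).
Local Notation rep_tuple := (rep_tuple F n s).
Implicit Types p : rep_tuple.

Definition secant_point p : tensor := \sum_a ptensor (p a).

Definition move_factor p a i (w : factor i) : rep_tuple :=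
  fun b => if b == a then dfwith (p a) w else p b.

(** Moving a single component makes the parametrization of the secants affine in
the parameter, with a tangent vector as slope. *)
Lemma secant_point_move p a i (w : factor i) e :
  secant_point (move_factor p a (p a i + e *: w))
  = secant_point p + e *: ptensor_at (p a) w.
Proof.
rewrite /secant_point (bigD1 a) //= [in RHS](bigD1 a) //= {1}/move_factor eqxx.
rewrite -[ptensor (dfwith _ _)]/(ptensor_at (p a) (p a i + e *: w)).
rewrite linearD linearZ /= ptensor_at_id addrAC; congr (_ + _ + _).
by apply: eq_bigr => b /negPf ba; rewrite /move_factor ba.
Qed.

Section PolyFamily.
Variable q : F -> rep_tuple.
Hypothesis qP : forall a i j, polyfun (fun t => q t a i 0 j).

Lemma polyfun_secant_point l : polyfun (fun t => secant_point (q t) l).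
Proof.
apply: (@eq_polyfun _ (fun t => \sum_a \prod_i q t a i 0 (l i))) => [t|].
  by rewrite sum_ffunE; apply: eq_bigr => a _; rewrite ffunE.
by apply: polyfun_sum => a; apply: polyfun_prod => i; exact: qP.
Qed.

Lemma tangent_sum_semicontinuous t0 :
  cofinitely (fun t =>
    (\dim (tangent_sum (q t0)) <= \dim (tangent_sum (q t)))%N).
Proof.
have [r r0 rP] : cofinitely (fun t =>
    (\rank (jacobian (q t0)) <= \rank (jacobian (q t)))%N).
  apply: rank_semicontinuous => x y.
  set a := (enum_val x).1.
  apply: eq_polyfun (tgen_polyfun (v := fun t => q t a) (enum_val x).2
    (enum_val y) (qP a)).
  by move=> t; rewrite mxE.
by exists r => // t /rP; rewrite !dim_tangent_sum.
Qed.

End PolyFamily.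

(** The differential of [f] at the secant point kills all the tangent spaces at
the [p a], hence everything. *)
Lemma tderiv_eq0 (f : {mpoly F[#|{: mindex n}|]}) p :
  (forall q, tpoly_eval (secant_point q) f = 0) -> tangent_sum p = fullv ->
  forall j, tpoly_eval (secant_point p) f^`M(j) = 0.
Proof.
move=> f0 p_full.
pose df := \col_j tpoly_eval (secant_point p) f^`M(j).
have : row_full (jacobian p).
  by rewrite /row_full -dim_tangent_sum p_full dim_tensor card_mindex.
move=> /row_full_inj jac_inj j.
have /matrixP/(_ j 0) : df = 0.
  apply: jac_inj; rewrite mulmx0; apply/colP => c; rewrite !mxE.
  set a := (enum_val c).1; set x := (enum_val c).2.
  have := @dderiv_eq0 F F_char0 _ f (fun y => secant_point p (enum_val y))
    (fun y => tgen (p a) x (enum_val y)).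
  rewrite /dderiv; under eq_bigr do rewrite mulrC.
  move=> E; rewrite -[RHS]E; first by apply: eq_bigr => y _; rewrite !mxE.
  move=> e; rewrite -(f0 (move_factor p a
    (p a (tag x) + e *: delta_mx 0 (tagged x)))).
  by apply: meval_eq => y; rewrite secant_point_move !ffunE.
by rewrite !mxE.
Qed.

(** The derivatives of [f] vanish at the secant points of the tuples whose
tangent spaces span everything.  On the line from [p0] to any tuple almost all
tuples are of that kind, so by continuation they vanish at all secant points. *)
Lemma vanishing_on_secants_eq0 (f : {mpoly F[#|{: mindex n}|]}) p0 :
  tangent_sum p0 = fullv ->
  (forall p, tpoly_eval (secant_point p) f = 0) -> f = 0.
Proof.
move=> p0_full; have [d] := ubnP (msize f); elim: d f => // d IH f.
rewrite ltnS => fd f0.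
suff df0 j : f^`M(j) = 0.
  have fE := mderiv_eq0_const F_char0 df0.
  by have := f0 p0; rewrite fE /tpoly_eval mevalC => ->; rewrite mpolyC0.
case: d IH fd => [|d] IH fd.
  by move: fd; rewrite leqn0 msize_poly_eq0 => /eqP->; rewrite mderiv0.
apply: IH; first by rewrite ltnS msize_mderiv.
move=> p.
pose q (t : F) : rep_tuple := fun a i => p0 a i + t *: (p a i - p0 a i).
have qP a i b : polyfun (fun t => q t a i 0 b).
  apply: (@eq_polyfun _
    (fun t => p0 a i 0 b + t * (p a i - p0 a i) 0 b)) => [t|].
    by rewrite !mxE.
  apply: polyfunD; first exact: polyfun_const.
  by apply: polyfunM; [exact: polyfun_id | exact: polyfun_const].
have -> : secant_point p = secant_point (q 1).
  apply: eq_bigr => a _; apply: eq_ptensor => i.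
  by rewrite /q scale1r addrC subrK.
apply: (@polyfun_eq0 F F_char0
  (fun t => tpoly_eval (secant_point (q t)) f^`M(j))).
  by apply: polyfun_meval => y; exact: polyfun_secant_point.
have [r r0 rP] := tangent_sum_semicontinuous qP 0.
exists r => // t /rP dim_qt; apply: tderiv_eq0 f0 _ _.
apply/eqP; rewrite eqEdim subvf -p0_full; apply: leq_trans dim_qt.
rewrite /tangent_sum; apply: eq_leq; congr (\dim _); apply: eq_bigr => a _.
by apply: eq_tangent => i; rewrite /q scale0r addr0.
Qed.

Lemma secant_fills_of_tangent p0 :
  (0 < s)%N -> tangent_sum p0 = fullv -> secant_fills F n s.
Proof.
move=> s_gt0 p0_full t t0; split=> // d f _ f0.
pose one : forall i, factor i := fun i => const_mx 1.
have one0 i : one i != 0.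
  by apply/rV0Pn; exists 0; rewrite mxE oner_neq0.
have span p : secant_spans s (secant_point p).
  pose q a i := if [forall i, p a i != 0] then p a i else one i.
  exists q; split=> [a i|]; first by rewrite /q; case: ifP => // /forallP.
  apply: rpred_sum => a _; case p_a: [forall i, p a i != 0].
    apply: memv_span; apply/mapP; exists a; rewrite ?mem_enum //.
    by apply: eq_ptensor => i; rewrite /q p_a.
  (* A term with a zero component is zero, so its point may be replaced. *)
  have /existsP[i] : [exists i, p a i == 0].
    by rewrite -[X in is_true X]negbK negb_exists p_a.
  move=> /eqP pai; rewrite (_ : ptensor _ = 0) ?mem0v //.
  by apply/ffunP => l; rewrite !ffunE (bigD1 i) //= pai mxE mul0r.
rewrite (@vanishing_on_secants_eq0 f p0) ?[tpoly_eval t _]meval0 // => p.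
have [p0'|p_neq0] := eqVneq (secant_point p) 0; last exact: f0.
(* The zero tensor is a limit of nonzero multiples of a decomposable one. *)
pose u : tensor := ptensor one.
have -> : tpoly_eval (secant_point p) f = tpoly_eval (0 *: u) f.
  by rewrite p0' scale0r.
apply: (@polyfun_eq0 F F_char0 (fun e => tpoly_eval (e *: u) f)).
  apply: polyfun_meval => y.
  apply: (@eq_polyfun _ (fun e => e * u (enum_val y))) => [e|].
    by rewrite [RHS]ffunE.
  by apply: polyfunM; [exact: polyfun_id | exact: polyfun_const].
exists 'X; rewrite ?polyX_eq0 // => e; rewrite hornerX => e0.
apply: f0; first by rewrite scaler_eq0 negb_or e0 ptensor_neq0.
exists (fun=> one); split=> //; rewrite rpredZ //; apply: memv_span.
by apply/mapP; exists (Ordinal s_gt0); rewrite ?mem_enum.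
Qed.

End Density.

(** * Matrix rank of tensors and secant varieties *)

Section FlatteningRank.
Variables (F : fieldType) (m : nat) (n : 'I_m.+1 -> nat).
Local Notation n' := (init_dims n).
Local Notation tensor := (tensor F n).

Lemma secant_spansE s (q : rep_tuple F n s) (t : tensor) :
  t \in <<[seq ptensor (q a) | a : 'I_s]>>%VS ->
  exists c : 'I_s -> F, t = \sum_a c a *: ptensor (q a).
Proof.
rewrite span_def big_image /= => /memv_sumP[us usP ->].
have /fin_all_exists[c cP] a : exists c, us a = c *: ptensor (q a).
  exact/vlineP/usP.
by exists c; apply: eq_bigr => a _; rewrite cP.
Qed.

Lemma index_section : exists g : mindex n' * 'I_(n ord_max).+1 -> mindex n,
  forall x, init_index (g x) = x.1 /\ g x ord_max = x.2.
Proof.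
have /fin_all_exists[g gP] (x : mindex n' * 'I_(n ord_max).+1) :
    exists l : mindex n, init_index l = x.1 /\ l ord_max = x.2.
  exact: index_exists.
by exists g.
Qed.

(** Every tensor is the sum over [b] of the tensor product of the [b]-th basis
tensor of the first factors with the [b]-th row of its matrix. *)
Lemma secant_fills_init_index : secant_fills F n #|{: mindex n'}|.
Proof.
move=> t t0; split=> // d f _; apply=> //.
have [g gP] := index_section.
pose w b : factor F n ord_max := \row_j t (g (b, j)).
pose b (a : 'I_#|{: mindex n'}|) : mindex n' := enum_val a.
(* A zero row is replaced by a nonzero vector, taken with coefficient 0, since
   points of a projective space need nonzero representatives. *)
pose w1 a := if w (b a) == 0 then const_mx 1 else w (b a).
pose q (a : 'I_#|{: mindex n'}|) : forall i, factor F n i :=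
  dfwith (fun i => delta_mx 0 (g (b a, ord0) i)) (w1 a).
exists q; split=> [a i|].
  rewrite /q; case: dfwithP => [|i' _].
    rewrite /w1; case: ifP => [_|/negbT //].
    by apply/rV0Pn; exists 0; rewrite mxE oner_neq0.
  by apply/rV0Pn; exists (g (b a, ord0) i'); rewrite mxE !eqxx oner_neq0.
have qE a l : ptensor (q a) l = (init_index l == b a)%:R * w1 a 0 (l ord_max).
  have [/= + _] := gP (b a, ord0); rewrite /q; set gl := g _ => <-.
  rewrite ptensor_tens ffunE dfwith_in; congr (_ * _); rewrite ffunE.
  have initE i : init (dfwith (fun i => delta_mx 0 (gl i)) (w1 a)) i 0
      (init_index l i) = (init_index l i == init_index gl i)%:R :> F.
    by rewrite /init dfwith_out ?neq_lift // mxE eqxx [init_index gl i]ffunE.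
  under eq_bigr do rewrite initE.
  have [->|ll] := eqVneq; first by rewrite big1 // => i _; rewrite eqxx.
  have [i li] : exists i, init_index l i != init_index gl i.
    apply/existsP; apply: contraNT ll; rewrite negb_exists => /forallP ll.
    by apply/eqP/ffunP => i; rewrite (eqP (negPn (ll i))).
  by rewrite (bigD1 i) //= (negPf li) mul0r.
have -> : t = \sum_a (w (b a) != 0)%:R *: ptensor (q a).
  apply/ffunP => l; rewrite sum_ffunE (bigD1 (enum_rank (init_index l))) //=.
  rewrite ffunE qE /w1 /b enum_rankK eqxx mul1r big1 ?addr0; last first.
    move=> a al; rewrite ffunE qE /b (_ : (init_index l == enum_val a) = false).
      by rewrite mul0r [_ *: _]mulr0.
    by apply: contraNF al => /eqP->; rewrite enum_valK.
  have -> : t l = w (init_index l) 0 (l ord_max).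
    rewrite mxE; congr (t _); apply/ffunP => i.
    have [/ffunP E1 E2] := gP (init_index l, l ord_max).
    case: (unliftP ord_max i) => [i' ->|-> //].
    by have := E1 i'; rewrite !ffunE.
  by case: eqVneq => [->|_]; rewrite ?mxE ?[_ *: _]mul0r // [_ *: _]mul1r.
apply: rpred_sum => a _; rewrite rpredZ //; apply: memv_span.
by apply/mapP; exists a; rewrite ?mem_enum.
Qed.

(** The minor of size s + 1 on the first rows and columns vanishes on sums of
[s] decomposable tensors, whose matrices factor through dimension [s]. *)
Lemma secant_fills_ge s : secant_fills F n s ->
  (minn (n ord_max).+1 (\prod_i (n' i).+1) <= s)%N.
Proof.
move=> fills; rewrite leqNgt; apply/negP; rewrite leq_min -card_mindex.
move=> /andP[sN sP]; have [g gP] := index_section.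
pose l (x y : 'I_s.+1) := g (enum_val (widen_ord sP x), widen_ord sN y).
have l_init x y : init_index (l x y) = enum_val (widen_ord sP x).
  by have [-> _] := gP (enum_val (widen_ord sP x), widen_ord sN y).
have l_last x y : l x y ord_max = widen_ord sN y.
  by have [_ ->] := gP (enum_val (widen_ord sP x), widen_ord sN y).
pose f : {mpoly F[#|{: mindex n}|]} :=
  \det (\matrix_(x, y) 'X_(enum_rank (l x y))).
have fE (u : tensor) : tpoly_eval u f = \det (\matrix_(x, y) u (l x y)).
  rewrite /tpoly_eval -det_map_mx; congr (\det _); apply/matrixP => x y.
  by rewrite !mxE /= mevalXU enum_rankK.
have f_homog : f \is (\sum_(x < s.+1) 1).-homog.
  by apply: dhomog_det => x y; rewrite mxE dhomogX; apply/eqP/mdeg1.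
pose t : tensor := \sum_z delta_fun F (l z z).
have tE x y : t (l x y) = (x == y)%:R.
  rewrite sum_ffunE (bigD1 x) //= ffunE big1 ?addr0 => [|z zx].
    congr (nat_of_bool _)%:R; apply/eqP/eqP => [|-> //].
    move/(congr1 (fun l : mindex n => l ord_max)).
    by rewrite !l_last => /(congr1 val)/= /val_inj.
  rewrite ffunE (_ : _ == _ = false) //; apply: contraNF zx => /eqP.
  move/(congr1 (@init_index _ n)); rewrite !l_init => /enum_val_inj.
  by move=> /(congr1 val)/= /val_inj->.
have ft : tpoly_eval t f = 1.
  rewrite fE -[RHS](det1 _ s.+1); congr (\det _).
  by apply/matrixP => x y; rewrite !mxE tE.
have t0 : t != 0.
  apply/eqP => /ffunP/(_ (l ord0 ord0)); rewrite tE eqxx ffunE => /eqP.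
  by rewrite oner_eq0.
have [_ /(_ _ f f_homog)] := fills t t0.
rewrite ft => f0; suff /eqP: (1 : F) = 0 by rewrite oner_eq0.
apply: f0 => u _ [q [_ /secant_spansE[c ->]]]; rewrite fE.
pose A := \matrix_(x < s.+1, a < s)
  (c a * ptensor (init (q a)) (enum_val (widen_ord sP x))).
pose B := \matrix_(a < s, y < s.+1) q a ord_max 0 (widen_ord sN y).
have -> : \matrix_(x, y) (\sum_a c a *: ptensor (q a)) (l x y) = A *m B.
  apply/matrixP => x y; rewrite !mxE sum_ffunE; apply: eq_bigr => a _.
  rewrite !mxE -[RHS]mulrA -(l_init x y) -(l_last x y) ptensor_tens.
  by rewrite [LHS]ffunE [X in _ *: X]ffunE.
apply/eqP; rewrite -[_ == 0]negbK -unitfE -unitmxE -row_free_unit /row_free.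
rewrite neq_ltn ltnS (leq_trans (mxrankM_maxl _ _)) //.
exact: rank_leq_col.
Qed.

End FlatteningRank.

(** * Unbalanced dimensions *)

Lemma sum_lt_prod_succ (I : finType) (f : I -> nat) :
  (\sum_i f i < \prod_i (f i).+1)%N.
Proof.
elim/big_ind2: _ => // x1 x2 y1 y2; nia.
Qed.

Section MainTheorem.
Variables (F : fieldType) (F_char0 : [pchar F] =i pred0).
Variables (m : nat) (n : 'I_m.+1 -> nat).
Hypotheses (m_gt0 : (0 < m)%N) (n_ge1 : forall i, (1 <= n i)%N).
Local Notation P := (\prod_i (init_dims n i).+1)%N.
Local Notation S := (\sum_i init_dims n i)%N.
Local Notation N := (n ord_max).
Hypothesis unbal : (P - S <= N - 1)%N.

Lemma sum_init_gt0 : (0 < S)%N.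
Proof. by rewrite (bigD1 (Ordinal m_gt0)) //= addn_gt0 n_ge1. Qed.

Lemma unbalanced_bound : (P < N + S)%N.
Proof.
have := sum_lt_prod_succ (init_dims n); have := n_ge1 ord_max; lia.
Qed.

Lemma subabundant_unbalanced s : (s <= P - S)%N -> subabundant n s.
Proof.
move=> sD; rewrite /subabundant prod_dims sum_dims.
have := unbalanced_bound; have := sum_lt_prod_succ (init_dims n).
move: sD; move: P S N => p e N; nia.
Qed.

Lemma T_true_unbalanced s : (s <= P - S)%N -> T_true F n s.
Proof.
move=> sD; have S_lt_P := sum_lt_prod_succ (init_dims n).
have sN : (s <= N.+1)%N by move: unbal sD; lia.
have [p [p0 dim_p]] := exists_large_tangent_sum F_char0 m_gt0 sN.
apply: T_true_from_point p0 _; rewrite geq_min; apply/orP; left.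
apply: leq_trans dim_p; rewrite sum_dims.
rewrite (minn_idPr _); last by move: sD S_lt_P; lia.
rewrite (minn_idPr _); last by move: sD S_lt_P; lia.
move: sN; nia.
Qed.

Lemma T_true_subabundant_bound s :
  T_true F n s -> subabundant n s -> (s <= P - S)%N.
Proof.
move=> [U [_ [p [p0 Up]] /(_ p p0 Up) dim_p]] sub.
have [w [ws wN]] := dim_tangent_sum_flattening p.
move: sub; rewrite -/(tangent_sum p) /tangent_sum dim_p /subabundant.
move=> sub; rewrite (minn_idPl sub); move: sub ws wN.
rewrite prod_dims sum_dims; have := sum_init_gt0.
move: P S N => P0 S0 N0 S_gt0 sub ws wN dim_le.
have [-> //|s_gt0] := posnP s.
have sP : (s < P0)%N.
  rewrite ltnNge; apply/negP => Ps.
  have : (P0 * (1 + (S0 + N0)) <= P0 * N0.+1)%N by apply: leq_trans sub; nia.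
  have : (0 < P0)%N by case: posnP dim_le sub => // ->; nia.
  nia.
(* The bound is increasing in w, because s < P, and w <= s. *)
have le_w : (w * P0 + s * (N0.+1 - w) <= s * (P0 - s + N0.+1))%N.
  rewrite -[X in (w * X)%N](subnKC (ltnW sP)) -[X in (_ - s + X)%N](subnKC wN).
  by have := leq_mul ws (leqnn (P0 - s)); lia.
have : (s * (1 + (S0 + N0)) <= s * (P0 - s + N0.+1))%N by apply: leq_trans le_w.
rewrite leq_pmul2l //; lia.
Qed.


Lemma secant_fills_unbalanced :
  secant_fills F n (minn N.+1 P).
Proof.
case: (leqP P N.+1) => [PN|NP].
  by rewrite -card_mindex; exact: secant_fills_init_index.
have [p [_ dim_p]] := exists_large_tangent_sum F_char0 m_gt0 (leqnn N.+1).
apply: (secant_fills_of_tangent F_char0 (p0 := p)) => //.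
apply/eqP; rewrite eqEdim subvf dim_tensor prod_dims.
apply: leq_trans dim_p; rewrite (minn_idPl _) ?subnn ?mul0n ?addn0 1?mulnC //.
have := unbalanced_bound; lia.
Qed.

End MainTheorem.

Theorem theorem4p4 (F : fieldType) (F_char0 : [pchar F]%R =i pred0)
    (m : nat) (k_ge3 : (3 <= m.+1)%N)
    (n : 'I_m.+1 -> nat)
    (n_ge1 : forall i, (1 <= n i)%N)
    (n_sorted : forall i j : 'I_m.+1, (i <= j)%N -> (n i <= n j)%N)
    (n_unbalanced : unbalanced n) :
  (forall s : nat,
     (T_true F n s /\ subabundant n s) <->
     (s <= \prod_(i < m.+1 | i != ord_max) (n i).+1
           - \sum_(i < m.+1 | i != ord_max) n i)%N) /\
  is_generic_rank F n
    (minn (n ord_max).+1 (\prod_(i < m.+1 | i != ord_max) (n i).+1)).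
Proof.
have m_gt0 : (0 < m)%N by move: k_ge3; lia.
move: n_unbalanced; rewrite /unbalanced prod_init_dims sum_init_dims => unbal.
split=> [s|].
  split=> [[T_s sub_s]|sD]; first exact: T_true_subabundant_bound T_s sub_s.
  split; first exact: T_true_unbalanced.
  exact: subabundant_unbalanced.
split; first exact: secant_fills_unbalanced.
exact: secant_fills_ge.
Qed.
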